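(* Let $\gamma_0 > 0$ and $0 \le r < 1$, and put $\gamma_1 = \tfrac12(1+\sqrt{3})$ and $\gamma_2 = \gamma_0\gamma_1$. For each integer $d \ge 2$ let $\Sigma = \Sigma_d$ be a real symmetric $d\times d$ matrix such that $\|\Sigma\| \le \gamma_0 d^{r/2}$. Then for all integers $m \ge 2$ and all integers $d \ge 2$ with $d \ge (2\gamma_2^2)^{1/(1-r)}$, $$\|\nabla R_m(\Sigma)\| \le \frac{(2e)^{1/2}\,\gamma_2^{m-1}}{[(m-1)!]^{1/2}}\, d^{-[1+(m-1)(1-r)]/2},$$ where $$\nabla R_m(\Sigma) = \sum_{k=m}^\infty \frac{(1/2)_k}{(d/2)_k}\,\frac{\nabla C_{(k)}(\Sigma)}{k!}.$$ In particular, for each fixed $m\ge 2$, $\|\nabla R_m(\Sigma)\| = O\big(d^{-[1+(m-1)(1-r)]/2}\big)$ as $d \to \infty$.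
   Context: $\|A\| = [\mathrm{tr}(A^2)]^{1/2}$ is the Frobenius norm of a real symmetric matrix $A$. For $a\in\mathbb{R}$, $(a)_k = a(a+1)\cdots(a+k-1)$ is the rising factorial, with $(a)_0=1$. The zonal polynomial of the one-part partition $(k)$, evaluated at a real symmetric $d \times d$ matrix $\Sigma$, is $$C_{(k)}(\Sigma) = \frac{k!}{(1/2)_k}\sum_{i_1+2i_2+\cdots+ki_k=k}\ \prod_{j=1}^k \frac{[\mathrm{tr}(\Sigma^j)]^{i_j}}{i_j!\,(2j)^{i_j}},$$ where the sum is over all nonnegative integers $i_1,\ldots,i_k$ with $i_1+2i_2+\cdots+ki_k=k$. For a continuously differentiable real-valued function $f$ on the space of real symmetric $d\times d$ matrices $\Sigma=(\sigma_{i,j})$ (regarded as a function of the entries $\sigma_{i,j}$, $i\le j$, with $\sigma_{j,i}=\sigma_{i,j}$), the gradient $\nabla f(\Sigma)$ is the symmetric $d\times d$ matrix with $(i,j)$ entry $\tfrac12(1+\delta_{i,j})\,\partial f(\Sigma)/\partial\sigma_{i,j}$, where $\delta_{i,j}$ is Kronecker's delta. Equivalently, it is the gradient with respect to the inner product $\langle H_1,H_2\rangle=\mathrm{tr}(H_1H_2)$. The matrix $\nabla R_m(\Sigma)$ is defined by the displayed term-by-term series; its convergence is implicit in the statement. Notation: $g_1(d)=O(g_2(d))$ as $d\to\infty$ (with $g_2\ge 0$) means there is a constant $\gamma>0$ with $|g_1(d)|\le\gamma g_2(d)$ for all sufficiently large $d$. *)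

(* Defs.v *)
From mathcomp Require Import all_boot all_order all_algebra.
From mathcomp Require Import all_classical all_reals all_analysis.

Set Implicit Arguments.
Unset Strict Implicit.
Unset Printing Implicit Defensive.

Import Order.TTheory GRing.Theory Num.Theory.
Import numFieldNormedType.Exports.

Local Open Scope ring_scope.
Local Open Scope classical_set_scope.

(* Frobenius norm, in the form [tr(A^2)]^(1/2) valid for symmetric A. *)
Definition frob_norm (R : realType) (d : nat) (A : 'M[R]_d) : R :=
  Num.sqrt (\tr (A *m A)).

Definition rising_fact (R : realType) (a : R) (k : nat) : R :=
  \prod_(i < k) (a + i%:R).

(* Zonal polynomial of the one-part partition (k).  The multiplicity i_(j+1)
   is [i j] for j < k; the constraint sum_j j i_j = k forces each multiplicity
   to be at most k, so ranging over 'I_k.+1 loses no term. *)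
Definition zonal (R : realType) (d k : nat) (Sigma : 'M[R]_d) : R :=
  k`!%:R / rising_fact (1 / 2) k *
  \sum_(i : {ffun 'I_k -> 'I_k.+1} | (\sum_(j < k) j.+1 * i j == k)%N)
    \prod_(j < k)
      (\tr (Sigma ^+ j.+1) ^+ i j / ((i j)`!%:R * (2 * j.+1)%:R ^+ i j)).

(* Sigma with sigma_(i,j) = sigma_(j,i) set to t. *)
Definition set_sym (R : realType) (d : nat) (Sigma : 'M[R]_d) (i j : 'I_d)
    (t : R) : 'M[R]_d :=
  \matrix_(k, l)
    if (k == i) && (l == j) || (k == j) && (l == i) then t else Sigma k l.

Definition sym_partial (R : realType) (d : nat) (f : 'M[R]_d -> R)
    (Sigma : 'M[R]_d) (i j : 'I_d) : R :=
  derive1 (fun t : R => f (set_sym Sigma i j t)) (Sigma i j).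

Definition sym_grad (R : realType) (d : nat) (f : 'M[R]_d -> R)
    (Sigma : 'M[R]_d) : 'M[R]_d :=
  \matrix_(i, j) (1 / 2 * (1 + (i == j)%:R) * sym_partial f Sigma i j).

Definition gradR_term (R : realType) (d : nat) (Sigma : 'M[R]_d) (k : nat) :
    'M[R]_d :=
  (rising_fact (1 / 2) k / rising_fact (d%:R / 2) k / k`!%:R)
    *: sym_grad (@zonal R d k) Sigma.

Definition gradR_psum (R : realType) (d m : nat) (Sigma : 'M[R]_d) (n : nat) :
    'M[R]_d :=
  \sum_(m <= k < n) gradR_term Sigma k.

(* Meaningful only when [gradR_psum m Sigma] converges. *)
Definition gradR (R : realType) (d m : nat) (Sigma : 'M[R]_d) : 'M[R]_d :=
  limn (gradR_psum m Sigma).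

(* Main.v *)
Require Import Defs.
From mathcomp Require Import all_boot all_order all_algebra.
From mathcomp Require Import all_classical all_reals all_analysis.
From mathcomp Require Import ring lra zify.

Set Implicit Arguments.
Unset Strict Implicit.
Unset Printing Implicit Defensive.

Import Order.TTheory GRing.Theory Num.Theory.
Import numFieldNormedType.Exports.

Local Open Scope ring_scope.
Local Open Scope classical_set_scope.

(** Write Q_k = (1/2)_k C_(k)(Sigma) / k! and p_j = tr(Sigma^j).  The defining
    sum of C_(k) says that Q_k is the coefficient of X^k in the power series
    exp(sum_(j >= 1) p_j X^j / (2 j)), that is, in det(1 - X Sigma)^(-1/2).
    Two identities follow ([zonal_sum_rec] and [sym_grad_zonal]):

      k Q_k = 1/2 sum_(j < k) p_(j+1) Q_(k-1-j),
      grad Q_k = 1/2 sum_(j < k) Q_(k-1-j) Sigma^j.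

    The first is the logarithmic derivative of the exponential; the second is
    deduced from the first by induction on k, with grad p_j = j Sigma^(j-1).

    Let s bound the norm of Sigma and put
    N_k = 1/2 sum_(j < k) |Sigma^j| |Q_(k-1-j)|.  By the triangle inequality
    |grad Q_k| <= N_k, and by Cauchy-Schwarz |p_(j+1)| <= s |Sigma^j|, so that
    k |Q_k| <= s N_k.  Isolating the term j = 0 of N_(k+1), in which the
    identity matrix has norm d^(1/2), and using |Sigma^(j+1)| <= s |Sigma^j| in
    the others gives N_(k+1) <= s (1 + d^(1/2) / (2 k)) N_k.  Dividing by the
    Pochhammer symbol (d/2)_(k+1) multiplies this rate by 1 / (d/2 + k), and

      s (1 + d^(1/2) / (2 k)) / (d/2 + k) <= (gamma1 s / d^(1/2)) / k^(1/2).

    This is where gamma1 comes from: it is the positive root of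
    g (g - 1) = 1/2, the value for which the difference of the two sides is, at
    k = 1 and up to a positive factor, a perfect square ([growth_rate_bound]).  Hence,
    with x = gamma1 s / d^(1/2), the k-th term of the series is at most
    d^(-1/2) x^(k-1) / ((k-1)!)^(1/2) ([gradR_term_le]).

    For s = gamma0 d^(r/2) one has x = gamma2 d^(-(1-r)/2), and the lower bound
    on d amounts to 2 x^2 <= 1.  Then (a + b)! >= a! b! factors the first term
    out of the tail, and Cauchy-Schwarz gives

      sum_i x^i / (i!)^(1/2)
        <= (sum_i (2 x^2)^i / i!)^(1/2) (sum_i 2^(-i))^(1/2) <= (2 e)^(1/2),

    which is the constant of the statement. *)

(** * The zonal sums as coefficients of an exponential *)

Definition zonal_sum (R : fieldType) (p : nat -> R) (k : nat) : R :=
  \sum_(i : {ffun 'I_k -> 'I_k.+1} | (\sum_(j < k) j.+1 * i j == k)%N)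
    \prod_(j < k) (p j ^+ i j / ((i j)`!%:R * (2 * j.+1)%:R ^+ i j)).

Definition factor_coef (R : fieldType) (p : nat -> R) (j i : nat) : R :=
  p j ^+ i / (i`!%:R * (2 * j.+1)%:R ^+ i).

(** Truncating each exponential at degree [n] in its own variable keeps
    everything a polynomial and leaves the coefficients of degree at most [n]
    of the product unchanged; for [n = k] the index set obtained by expanding
    the product is the one of [zonal_sum p k]. *)
Definition trunc_factor (R : fieldType) (p : nat -> R) (n j : nat) : {poly R} :=
  \sum_(i < n.+1) factor_coef p j i *: 'X^(j.+1 * i).

Definition trunc_prod (R : fieldType) (p : nat -> R) (n m : nat) : {poly R} :=
  \prod_(j < m) trunc_factor p n j.

Lemma zonal_sum_coef (R : fieldType) (p : nat -> R) (k : nat) :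
  zonal_sum p k = (trunc_prod p k k)`_k.
Proof.
rewrite /trunc_prod /trunc_factor bigA_distr_bigA coef_sum /zonal_sum big_mkcond.
apply: eq_bigr => f _.
rewrite scaler_prod -expr_sum coefZ coefXn eq_sym.
by case: eqP => _; rewrite ?mulr1 ?mulr0.
Qed.

(** The Euler operator ['X * d/dX] multiplies the exponential of
    [p j 'X^(j.+1) / (2 (j.+1))] by [p j 'X^(j.+1) / 2]; truncation spoils this
    only by one monomial of high degree. *)
Lemma trunc_factor_deriv (R : numFieldType) (p : nat -> R) (n j : nat) :
  exists c : R, 'X * (trunc_factor p n j)^`() =
    (p j / 2) *: ('X^(j.+1) * trunc_factor p n j) + c *: 'X^(j.+1 * n.+1).
Proof.
exists (- (p j / 2 * factor_coef p j n)).
rewrite /trunc_factor raddf_sum mulr_sumr big_ord_recl /=.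
rewrite muln0 derivZ derivXn mulr0n scaler0 mulr0 add0r.
rewrite mulr_sumr scaler_sumr [in RHS]big_ord_recr /=.
have cS i : factor_coef p j i.+1 * (j.+1 * i.+1)%:R = p j / 2 * factor_coef p j i.
  rewrite /factor_coef factS !exprS !natrM.
  field.
  rewrite ?pnatr_eq0 ?expf_neq0 ?pnatr_eq0 //=.
  by rewrite !nat1r !pnatr_eq0 -lt0n fact_gt0.
have XE i : 'X^(j.+1) * 'X^(j.+1 * i) = 'X^(j.+1 * i.+1) :> {poly R}.
  by rewrite -exprD mulnS.
rewrite -[in RHS]scalerAr XE scaleNr !scalerA addrK; apply: eq_bigr => i _.
rewrite derivZ derivXn -[in RHS]scalerAr XE scalerA -cS /bump add1n.
by rewrite -scalerAr (mulrnAr ('X : {poly R})) -exprS prednK // -scaler_nat scalerA.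
Qed.

Lemma trunc_prod_deriv (R : numFieldType) (p : nat -> R) (n m : nat) :
  exists r : {poly R}, 'X * (trunc_prod p n m)^`() =
    (\sum_(j < m) (p j / 2) *: 'X^(j.+1)) * trunc_prod p n m + 'X^(n.+1) * r.
Proof.
rewrite /trunc_prod; elim: m => [|m [r IH]].
  by exists 0; rewrite !big_ord0 derivC mulr0 mul0r mulr0 addr0.
have [c Hc] := trunc_factor_deriv p n m.
exists (r * trunc_factor p n m
  + (\prod_(j < m) trunc_factor p n j) * (c *: 'X^(m * n.+1))).
rewrite !big_ord_recr /= derivM mulrDr mulrA IH [X in _ + X = _]mulrCA Hc.
rewrite mulSn exprD -!mul_polyC.
set S := \sum_(j < m) _; move: S (\prod_(j < m) _) (trunc_factor p n m) => S P F.
ring.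
Qed.

Lemma trunc_prod_coef0 (R : fieldType) (p : nat -> R) (n m : nat) :
  (trunc_prod p n m)`_0 = 1.
Proof.
rewrite -horner_coef0 horner_prod big1 // => j _.
rewrite /trunc_factor horner_sum big_ord_recl big1 /=.
  rewrite /factor_coef fact0 !expr0 !mul1r invr1 muln0 expr0.
  by rewrite alg_polyC hornerC addr0.
by move=> i _; rewrite hornerZ hornerXn /bump /= mulnDr muln1 addSn exprS mul0r mulr0.
Qed.

(** Comparing the coefficients of degree [k.+1 <= n] in [trunc_prod_deriv]: the
    truncation error has too high a degree to contribute. *)
Lemma trunc_prod_rec (R : numFieldType) (p : nat -> R) (n k : nat) : (k < n)%N ->
  k.+1%:R * (trunc_prod p n n)`_k.+1 =
  1 / 2 * \sum_(j < k.+1) p j * (trunc_prod p n n)`_(k - j).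
Proof.
move=> kn; have [r Hr] := trunc_prod_deriv p n n.
have := congr1 (fun q : {poly R} => q`_k.+1) Hr.
rewrite coefXM /= coef_deriv coefD coefXnM ltnS kn addr0 mulr_natl => ->.
rewrite mulr_suml coef_sum mulr_sumr.
rewrite (big_ord_widen n (fun j => 1 / 2 * (p j * (trunc_prod p n n)`_(k - j)))) //.
rewrite [RHS]big_mkcond; apply: eq_bigr => j _.
rewrite -scalerAl coefZ coefXnM ltnS subSS leqNgt.
by case: ltnP => _ /=; rewrite ?mulr0 //; ring.
Qed.

Lemma zonal_sum0 (R : fieldType) (p : nat -> R) : zonal_sum p 0 = 1.
Proof. by rewrite zonal_sum_coef trunc_prod_coef0. Qed.

(** The recurrence and the constant coefficient determine the coefficients, so
    they do not depend on the level [n] of truncation. *)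
Lemma zonal_sum_trunc (R : numFieldType) (p : nat -> R) (n k : nat) : (k <= n)%N ->
  (trunc_prod p n n)`_k = zonal_sum p k.
Proof.
elim/ltn_ind: k n => -[|k] IH n kn.
  by rewrite zonal_sum0 trunc_prod_coef0.
have k1 : (k.+1%:R : R) != 0 by rewrite pnatr_eq0.
rewrite zonal_sum_coef; apply: (mulfI k1); rewrite !trunc_prod_rec //.
congr (_ * _); apply: eq_bigr => j _.
by rewrite !IH //; lia.
Qed.

Lemma zonal_sum_rec (R : numFieldType) (p : nat -> R) (k : nat) :
  k.+1%:R * zonal_sum p k.+1 = 1 / 2 * \sum_(j < k.+1) p j * zonal_sum p (k - j).
Proof.
rewrite zonal_sum_coef trunc_prod_rec //; congr (_ * _); apply: eq_bigr => j _.
by rewrite zonal_sum_trunc //; lia.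
Qed.

(** Differentiating the exponential series multiplies it by the derivative of
    its exponent.  The recurrence alone gives this, by induction on [k]: in the
    derivative of its right-hand side, the terms where a [zonal_sum] is
    differentiated are double sums, which the recurrence evaluates after the
    order of summation is exchanged. *)
Lemma is_derive_zonal_sum (R : realType) (p : R -> nat -> R) (dp : nat -> R) (t : R) :
  (forall j, is_derive t 1 (p^~ j) (j.+1%:R * dp j)) ->
  forall k, is_derive t 1 (fun s => zonal_sum (p s) k)
    (1 / 2 * \sum_(j < k) dp j * zonal_sum (p t) (k - j.+1)).
Proof.
move=> Hp; elim/ltn_ind => -[|k] IH.
  rewrite big_ord0 mulr0 (_ : (fun s => _) = cst 1); first exact: is_derive_cst.
  by apply/funext => s; rewrite zonal_sum0.
have k1 : (k.+1%:R : R) != 0 by rewrite pnatr_eq0.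
have -> : (fun s => zonal_sum (p s) k.+1) = k.+1%:R^-1 \*: (1 / 2 \*:
    (\sum_(j < k.+1) (fun s => p s j * zonal_sum (p s) (k - j)))).
  apply/funext => s /=; apply: (mulfI k1); rewrite zonal_sum_rec.
  by rewrite fct_sumE /GRing.scale /= mulVKf.
pose q i := zonal_sum (p t) i.
pose dq i := 1 / 2 * \sum_(j < i) dp j * q (i - j.+1)%N.
have H : is_derive t 1 (\sum_(j < k.+1) (fun s => p s j * zonal_sum (p s) (k - j)))
  (\sum_(j < k.+1) (p t j * dq (k - j)%N + q (k - j)%N * (j.+1%:R * dp j))).
  apply: is_derive_sum => j.
  have D := IH (k - j)%N; rewrite ltnS leq_subr in D.
  exact: is_deriveM (Hp j) (D isT).
apply: is_derive_eq.
rewrite /GRing.scale /=; apply: (mulfI k1); rewrite mulVKf // mulrCA; congr (_ * _).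
rewrite big_split /=.
(* [G i j] is the summand of the double sum, extended by zero to a square. *)
have -> : \sum_(j < k.+1) p t j * dq (k - j)%N =
    \sum_(i < k.+1) dp i * ((k - i)%:R * q (k - i)%N).
  pose G i j :=
    if (i + j < k)%N then dp i * (1 / 2 * (p t j * q (k - (i + j).+1)%N)) else 0.
  transitivity (\sum_(j < k.+1) \sum_(i < k.+1) G i j).
    apply: eq_bigr => j _; rewrite /dq !mulr_sumr.
    rewrite (big_ord_widen k.+1
      (fun i => p t j * (1 / 2 * (dp i * q (k - j - i.+1)%N)))); last lia.
    rewrite big_mkcond; apply: eq_bigr => i _; rewrite /G ltn_subRL addnC.
    by case: ifP => // _; rewrite -subnDA addnS addnC; ring.
  rewrite exchange_big; apply: eq_bigr => i _ /=.
  have [ik|] := ltnP i k; last first.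
    move=> ki; have -> : (k - i = 0)%N by apply/eqP; rewrite subn_eq0.
    rewrite mul0r mulr0 big1 // => j _; rewrite /G ifF //; lia.
  have -> : (k - i = (k - i.+1).+1)%N by lia.
  rewrite /q zonal_sum_rec mulr_sumr mulr_sumr.
  rewrite (big_ord_widen k.+1 (fun j =>
    dp i * (1 / 2 * (p t j * zonal_sum (p t) (k - i.+1 - j))))); last lia.
  rewrite [RHS]big_mkcond; apply: eq_bigr => j _; rewrite /G.
  have -> : (i + j < k)%N = (j < (k - i.+1).+1)%N by lia.
  by case: ifP => // _; rewrite -subnDA addSn.
rewrite -big_split mulr_sumr; apply: eq_bigr => i _ /=.
have ik : (i <= k)%N by rewrite -ltnS.
rewrite subSS -/(q _) natrB // -[k.+1%:R]natr1 -[i.+1%:R]natr1; ring.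
Qed.

(** * Frobenius norms *)

(** By Lagrange's identity, twice the difference of the two sides is a sum of
    squares. *)
Lemma cauchy_schwarz (R : realFieldType) (I : finType) (a b : I -> R) :
  (\sum_i a i * b i) ^+ 2 <= (\sum_i a i ^+ 2) * (\sum_i b i ^+ 2).
Proof.
have H : 0 <= \sum_i \sum_j (a i * b j - a j * b i) ^+ 2.
  by apply: sumr_ge0 => i _; apply: sumr_ge0 => j _; apply: sqr_ge0.
have E : \sum_i \sum_j (a i * b j - a j * b i) ^+ 2 =
    2 * ((\sum_i a i ^+ 2) * (\sum_i b i ^+ 2) - (\sum_i a i * b i) ^+ 2).
  have -> : (\sum_i a i ^+ 2) * (\sum_i b i ^+ 2) =
            \sum_i \sum_j a i ^+ 2 * b j ^+ 2 by exact: big_distrlr.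
  have -> : (\sum_i a i * b i) ^+ 2 = \sum_i \sum_j (a i * b i) * (a j * b j).
    by rewrite expr2 big_distrlr.
  have swap : \sum_i \sum_j a i ^+ 2 * b j ^+ 2 =
      \sum_i \sum_j a j ^+ 2 * b i ^+ 2 by rewrite exchange_big.
  rewrite mulrBr !mulr_natl !mulr2n {2}swap -!big_split -sumrB.
  apply: eq_bigr => i _ /=; rewrite -!big_split -sumrB.
  by apply: eq_bigr => j _ /=; ring.
by move: H; rewrite E pmulr_rge0 // subr_ge0.
Qed.

Definition l2norm (R : rcfType) (I : finType) (a : I -> R) : R :=
  Num.sqrt (\sum_i a i ^+ 2).

Lemma l2norm_ge0 (R : rcfType) (I : finType) (a : I -> R) : 0 <= l2norm a.
Proof. exact: sqrtr_ge0. Qed.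

Lemma sqr_l2norm (R : rcfType) (I : finType) (a : I -> R) :
  l2norm a ^+ 2 = \sum_i a i ^+ 2.
Proof. by rewrite sqr_sqrtr // sumr_ge0 // => i _; apply: sqr_ge0. Qed.

Lemma l2norm_dot (R : rcfType) (I : finType) (a b : I -> R) :
  `|\sum_i a i * b i| <= l2norm a * l2norm b.
Proof.
rewrite -ler_sqr ?nnegrE ?mulr_ge0 ?l2norm_ge0 //.
by rewrite real_normK ?num_real // exprMn !sqr_l2norm cauchy_schwarz.
Qed.

Lemma l2normD (R : rcfType) (I : finType) (a b : I -> R) :
  l2norm (fun i => a i + b i) <= l2norm a + l2norm b.
Proof.
rewrite -ler_sqr ?nnegrE ?addr_ge0 ?l2norm_ge0 //.
rewrite sqrrD !sqr_l2norm.
have -> : \sum_i (a i + b i) ^+ 2 =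
    \sum_i a i ^+ 2 + (\sum_i a i * b i) *+ 2 + \sum_i b i ^+ 2.
  by rewrite -sumrMnl -!big_split; apply: eq_bigr => i _; rewrite sqrrD.
by rewrite lerD2r lerD2l lerMn2r (le_trans (ler_norm _)) ?l2norm_dot ?orbT.
Qed.

(** [frob_norm] is the square root of a trace which may be negative when the
    matrix is not symmetric; this version is a norm on all matrices and agrees
    with it on symmetric ones ([frob_norm_sym]). *)
Definition fnorm (R : rcfType) (d : nat) (A : 'M[R]_d) : R :=
  l2norm (fun ij : 'I_d * 'I_d => A ij.1 ij.2).

Lemma sqr_fnorm (R : rcfType) (d : nat) (A : 'M[R]_d) :
  fnorm A ^+ 2 = \sum_i \sum_j A i j ^+ 2.
Proof. by rewrite sqr_l2norm pair_bigA. Qed.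

Lemma fnorm_ge0 (R : rcfType) (d : nat) (A : 'M[R]_d) : 0 <= fnorm A.
Proof. exact: l2norm_ge0. Qed.

Lemma fnorm_entry (R : rcfType) (d : nat) (A : 'M[R]_d) i j :
  `|A i j| <= fnorm A.
Proof.
rewrite -ler_sqr ?nnegrE ?fnorm_ge0 // real_normK ?num_real // sqr_l2norm.
rewrite (bigD1 (i, j)) //= lerDl sumr_ge0 // => ij _; exact: sqr_ge0.
Qed.

Lemma fnormD (R : rcfType) (d : nat) (A B : 'M[R]_d) :
  fnorm (A + B) <= fnorm A + fnorm B.
Proof.
apply: le_trans (l2normD _ _); rewrite le_eqVlt; apply/orP; left; apply/eqP.
by congr Num.sqrt; apply: eq_bigr => ij _; rewrite mxE.
Qed.

Lemma fnormZ (R : rcfType) (d : nat) (c : R) (A : 'M[R]_d) :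
  fnorm (c *: A) = `|c| * fnorm A.
Proof.
apply/eqP; rewrite -(@eqrXn2 _ 2) ?mulr_ge0 ?fnorm_ge0 //; apply/eqP.
rewrite exprMn real_normK ?num_real // !sqr_l2norm mulr_sumr.
by apply: eq_bigr => ij _; rewrite mxE exprMn.
Qed.

Lemma fnorm0 (R : rcfType) (d : nat) : fnorm (0 : 'M[R]_d) = 0.
Proof. by rewrite -(scale0r 0) fnormZ normr0 mul0r. Qed.

Lemma fnorm_sum (R : rcfType) (d : nat) (I : Type) (s : seq I) (P : pred I)
    (F : I -> 'M[R]_d) :
  fnorm (\sum_(i <- s | P i) F i) <= \sum_(i <- s | P i) fnorm (F i).
Proof.
elim/big_rec2 : _ => [|i y x _ H]; first by rewrite fnorm0.
by rewrite (le_trans (fnormD _ _)) // lerD2l.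
Qed.

Lemma fnormM (R : rcfType) (d : nat) (A B : 'M[R]_d) :
  fnorm (A *m B) <= fnorm A * fnorm B.
Proof.
rewrite -ler_sqr ?nnegrE ?mulr_ge0 ?fnorm_ge0 // exprMn !sqr_fnorm.
rewrite [X in _ * X]exchange_big big_distrlr /=.
apply: ler_sum => i _; apply: ler_sum => j _.
by rewrite mxE cauchy_schwarz.
Qed.

Lemma fnorm1 (R : rcfType) (d : nat) : fnorm (1%:M : 'M[R]_d) = Num.sqrt d%:R.
Proof.
apply/eqP; rewrite -(@eqrXn2 _ 2) ?fnorm_ge0 ?sqrtr_ge0 // sqr_fnorm.
rewrite sqr_sqrtr //; apply/eqP.
rewrite -[in RHS](card_ord d) -sumr_const; apply: eq_bigr => i _.
rewrite (bigD1 i) //= mxE eqxx expr1n big1 ?addr0 // => j ji.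
by rewrite mxE eq_sym (negbTE ji) expr0n.
Qed.

Lemma frob_norm_sym (R : realType) (d : nat) (A : 'M[R]_d) :
  A^T = A -> frob_norm A = fnorm A.
Proof.
move=> As; rewrite /frob_norm /fnorm /l2norm; congr Num.sqrt.
rewrite -(pair_bigA _ (fun i j => A i j ^+ 2)) /=; apply: eq_bigr => i _.
by rewrite mxE; apply: eq_bigr => j _; rewrite -[in X in _ * X]As mxE.
Qed.

Lemma mxtrace_le (R : rcfType) (d : nat) (A B : 'M[R]_d) :
  `|\tr (A *m B)| <= fnorm A * fnorm B.
Proof.
have -> : \tr (A *m B) = \sum_(ij : 'I_d * 'I_d) A ij.1 ij.2 * B ij.2 ij.1.
  rewrite -(pair_bigA _ (fun i j => A i j * B j i)) /=.
  by apply: eq_bigr => i _; rewrite mxE.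
apply: le_trans (l2norm_dot _ _) _; rewrite -!/(fnorm _) ler_wpM2l ?fnorm_ge0 //.
rewrite -ler_sqr ?nnegrE ?fnorm_ge0 ?l2norm_ge0 // sqr_l2norm sqr_fnorm.
by rewrite exchange_big pair_bigA.
Qed.

(** * The gradient of the zonal polynomials *)

(** Matrix powers do not commute with the direction [H], so the derivative is
    the sum over the positions at which [H] may be inserted; only under the
    trace do these terms become equal. *)
Lemma is_derive_mx_exp (R : realType) (d : nat) (M : R -> 'M[R]_d)
    (H : 'M[R]_d) (t : R) :
  (forall k l, is_derive t 1 (fun s => M s k l) (H k l)) ->
  forall n k l, is_derive t 1 (fun s => (M s ^+ n) k l)
    ((\sum_(a < n) M t ^+ a *m H *m M t ^+ (n - a.+1)) k l).
Proof.
move=> HM; elim=> [|n IH] k l.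
  rewrite big_ord0 [X in is_derive _ _ _ X]mxE.
  exact: (is_derive_cst ((1%:M : 'M[R]_d) k l)).
have -> : (fun s => (M s ^+ n.+1) k l) =
    \sum_(m < d) (fun s => M s k m * (M s ^+ n) m l).
  by apply/funext => s; rewrite fct_sumE exprS mxE.
have -> : \sum_(a < n.+1) M t ^+ a *m H *m M t ^+ (n.+1 - a.+1) =
    H *m M t ^+ n +
    M t *m \sum_(a < n) M t ^+ a *m H *m M t ^+ (n - a.+1).
  rewrite big_ord_recl expr0 mul1mx subn1 mulmx_sumr; congr (_ + _).
  by apply: eq_bigr => a _; rewrite subSS exprS -mulmxE !mulmxA.
apply: is_derive_eq; rewrite !mxE addrC -big_split /=.
by apply: eq_bigr => m _; rewrite /GRing.scale /= [H k m * _]mulrC.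
Qed.

Lemma is_derive_trace_exp (R : realType) (d : nat) (M : R -> 'M[R]_d)
    (H : 'M[R]_d) (t : R) :
  (forall k l, is_derive t 1 (fun s => M s k l) (H k l)) ->
  forall n, is_derive t 1 (fun s => \tr (M s ^+ n.+1))
    (n.+1%:R * \tr (M t ^+ n *m H)).
Proof.
move=> HM n.
have -> : (fun s => \tr (M s ^+ n.+1)) =
    \sum_(i < d) (fun s => (M s ^+ n.+1) i i).
  by apply/funext => s; rewrite fct_sumE.
have D i : is_derive t 1 (fun s => (M s ^+ n.+1) i i) _ :=
  is_derive_mx_exp HM n.+1 i i.
apply: is_derive_eq.
transitivity (\tr (\sum_(a < n.+1) M t ^+ a *m H *m M t ^+ (n.+1 - a.+1))) => //.
rewrite raddf_sum /= -[in n.+1%:R](card_ord n.+1) mulr_natl -sumr_const.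
apply: eq_bigr => a _; rewrite mxtrace_mulC mulmxA; congr (\tr (_ *m H)).
by rewrite mulmxE -exprD subSS subnK // -ltnS.
Qed.

Lemma set_sym_id (R : realType) (d : nat) (S : 'M[R]_d) (i j : 'I_d) :
  S^T = S -> set_sym S i j (S i j) = S.
Proof.
move=> Ss; apply/matrixP => k l; rewrite mxE.
case: ifP => // /orP[] /andP[/eqP -> /eqP ->] //.
by rewrite -[in RHS]Ss mxE.
Qed.

Lemma is_derive_set_sym (R : realType) (d : nat) (S : 'M[R]_d)
    (i j k l : 'I_d) (t : R) :
  is_derive t 1 (fun s => set_sym S i j s k l)
    ((\matrix_(k, l) ((k == i) && (l == j) || (k == j) && (l == i))%:R
      : 'M[R]_d) k l).
Proof.
rewrite mxE; case c : (_ || _).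
  have -> : (fun s => set_sym S i j s k l) = id by apply/funext => s; rewrite mxE c.
  exact: is_derive_id.
have -> : (fun s => set_sym S i j s k l) = cst (S k l).
  by apply/funext => s; rewrite mxE c.
exact: is_derive_cst.
Qed.

Lemma mx_exp_sym (R : comNzRingType) (d : nat) (S : 'M[R]_d) n :
  S^T = S -> (S ^+ n)^T = S ^+ n.
Proof.
move=> Ss; elim: n => [|n IH]; first exact: trmx1.
by rewrite exprS -[in RHS]mulmxE trmx_mul IH Ss mulmxE -exprSr exprS.
Qed.

(** The direction in which [set_sym] moves is [delta_mx i j + delta_mx j i] off
    the diagonal and half of that on it, and the trace of a symmetric [A] against
    [delta_mx i j + delta_mx j i] is [2 * A i j]; the weight in [sym_grad] makes
    up for both factors. *)
Lemma trace_set_sym_dir (R : realType) (d : nat) (A : 'M[R]_d) (i j : 'I_d) :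
  A^T = A ->
  1 / 2 * (1 + (i == j)%:R) * \tr (A *m
    \matrix_(k, l) ((k == i) && (l == j) || (k == j) && (l == i))%:R) = A i j.
Proof.
move=> As; set H := (X in A *m X).
have E : (1 + (i == j)%:R) *: H = delta_mx i j + delta_mx j i.
  apply/matrixP => k l; rewrite !mxE; case: (eqVneq i j) => [->|ij].
    by rewrite orbb mulrDl mul1r.
  rewrite addr0 mul1r; case: (eqVneq k i) => [->|ki].
    by rewrite (negbTE ij) /= orbF addr0.
  by rewrite /= add0r.
rewrite -mulrA -mxtraceZ scalemxAr E mulmxDr mxtraceD.
have tr_delta (k l : 'I_d) : \tr (A *m delta_mx k l) = A l k.
  rewrite mxtrace_mulC /mxtrace (bigD1 k) //= mxE (bigD1 l) //= !mxE !eqxx mul1r.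
  rewrite !big1 ?addr0 // => m mk.
    by rewrite mxE big1 // => p _; rewrite mxE (negbTE mk) mul0r.
  by rewrite mxE (negbTE mk) andbF mul0r.
have Aji : A j i = A i j by rewrite -[in LHS]As mxE.
by rewrite !tr_delta Aji; lra.
Qed.

Definition trpow (R : realType) (d : nat) (S : 'M[R]_d) (j : nat) : R :=
  \tr (S ^+ j.+1).

Lemma sym_grad_zonal (R : realType) (d k : nat) (S : 'M[R]_d) : S^T = S ->
  sym_grad (@zonal R d k) S = (k`!%:R / rising_fact (1 / 2) k) *:
    (1 / 2 *: \sum_(j < k) zonal_sum (trpow S) (k - j.+1) *: S ^+ j).
Proof.
move=> Ss; apply/matrixP => i j; rewrite mxE /sym_partial derive1E.
set H : 'M[R]_d :=
  \matrix_(k, l) ((k == i) && (l == j) || (k == j) && (l == i))%:R.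
have HM k' l' : is_derive (S i j) 1 (fun s => set_sym S i j s k' l') (H k' l').
  exact: is_derive_set_sym.
have D : is_derive (S i j) 1 (fun s => zonal_sum (trpow (set_sym S i j s)) k) _ :=
  is_derive_zonal_sum (p := fun s => trpow (set_sym S i j s))
    (is_derive_trace_exp HM) k.
have -> : (fun t => zonal k (set_sym S i j t)) = (k`!%:R / rising_fact (1 / 2) k)
    \*: (fun s => zonal_sum (trpow (set_sym S i j s)) k) by [].
rewrite deriveZ // derive_val set_sym_id // mxE /GRing.scale /= mulrCA.
congr (_ * _); rewrite mxE mulrCA; congr (_ * _).
rewrite mulr_sumr summxE; apply: eq_bigr => a _.
by rewrite mulrA trace_set_sym_dir ?mx_exp_sym // mxE mulrC.
Qed.

(** * Bounding the terms of the series *)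

Lemma rising_fact_gt0 (R : realType) (a : R) k : 0 < a -> 0 < rising_fact a k.
Proof. by move=> a0; apply: prodr_gt0 => i _; rewrite ltr_wpDr. Qed.

Definition grad_majorant (R : realType) (d : nat) (S : 'M[R]_d) (k : nat) : R :=
  1 / 2 * \sum_(j < k) fnorm (S ^+ j) * `|zonal_sum (trpow S) (k - j.+1)|.

Lemma grad_majorant_ge0 (R : realType) (d : nat) (S : 'M[R]_d) (k : nat) :
  0 <= grad_majorant S k.
Proof.
rewrite mulr_ge0 // sumr_ge0 // => j _; by rewrite mulr_ge0 ?fnorm_ge0.
Qed.

Lemma gradR_termE (R : realType) (d k : nat) (S : 'M[R]_d) : S^T = S ->
  gradR_term S k = (rising_fact (d%:R / 2) k)^-1 *:
    (1 / 2 *: \sum_(j < k) zonal_sum (trpow S) (k - j.+1) *: S ^+ j).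
Proof.
move=> Ss; rewrite /gradR_term sym_grad_zonal // scalerA; congr (_ *: _).
have r0 : rising_fact (1 / 2 : R) k != 0 by rewrite gt_eqF ?rising_fact_gt0.
have f0 : k`!%:R != 0 :> R by rewrite pnatr_eq0 -lt0n fact_gt0.
set a := rising_fact _ k in r0 *; set b := (rising_fact _ k)^-1.
set c := k`!%:R in f0 *.
by field; rewrite r0 f0.
Qed.

Lemma gradR_term_sym (R : realType) (d k : nat) (S : 'M[R]_d) : S^T = S ->
  (gradR_term S k)^T = gradR_term S k.
Proof.
move=> Ss.
have trZ c (A : 'M[R]_d) : (c *: A)^T = c *: A^T.
  by apply/matrixP => i j; rewrite !mxE.
rewrite gradR_termE // !trZ linear_sum /=.
congr (_ *: (_ *: _)); apply: eq_bigr => j _.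
by rewrite trZ mx_exp_sym.
Qed.

Lemma fnorm_gradR_term (R : realType) (d k : nat) (S : 'M[R]_d) :
  S^T = S -> (0 < d)%N ->
  fnorm (gradR_term S k) <= grad_majorant S k / rising_fact (d%:R / 2) k.
Proof.
move=> Ss d0; rewrite gradR_termE // !fnormZ.
have rf : 0 < rising_fact (d%:R / 2 : R) k by rewrite rising_fact_gt0 ?divr_gt0 ?ltr0n.
rewrite gtr0_norm ?invr_gt0 // mulrC ler_pM2r ?invr_gt0 //.
rewrite ger0_norm // ler_wpM2l //; apply: le_trans (fnorm_sum _ _ _) _.
by apply: ler_sum => j _; rewrite fnormZ mulrC.
Qed.

(** The same majorant controls the value and the gradient, because the
    recurrence for the value and the formula for the gradient differ only in
    having [\tr (S ^+ j.+1)] for [S ^+ j]. *)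
Lemma norm_zonal_sum (R : realType) (d k : nat) (S : 'M[R]_d) (s : R) :
  fnorm S <= s -> k.+1%:R * `|zonal_sum (trpow S) k.+1| <= s * grad_majorant S k.+1.
Proof.
move=> Ss; rewrite -[X in X * _]ger0_norm // -normrM zonal_sum_rec normrM ger0_norm //.
rewrite mulrCA ler_wpM2l // mulr_sumr; apply: le_trans (ler_norm_sum _ _ _) _.
apply: ler_sum => j _; rewrite normrM subSS mulrA ler_wpM2r //.
rewrite /trpow exprSr; apply: le_trans (mxtrace_le _ _) _.
by rewrite mulrC ler_wpM2r ?fnorm_ge0.
Qed.

(** The term of index 0 is isolated because the identity matrix has norm
    [Num.sqrt d] instead of a power of [s]; all the others are shifted down. *)
Lemma grad_majorantS (R : realType) (d k : nat) (S : 'M[R]_d) (s : R) :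
  fnorm S <= s -> grad_majorant S k.+2 <=
    s * (1 + Num.sqrt d%:R / (2 * k.+1%:R)) * grad_majorant S k.+1.
Proof.
move=> Ss; rewrite {1}/grad_majorant big_ord_recl expr0 fnorm1 mulrDr.
rewrite subSS subn0 mulrDr mulr1 mulrDl addrC lerD //.
  rewrite mulrCA ler_wpM2l // mulr_sumr; apply: ler_sum => j _.
  rewrite subSS mulrA ler_wpM2r // exprS; apply: le_trans (fnormM _ _) _.
  by rewrite ler_wpM2r ?fnorm_ge0.
have := norm_zonal_sum k Ss; set q := `|_|; set N := grad_majorant _ _ => H.
have k1 : 0 < k.+1%:R :> R by [].
have -> : s * (Num.sqrt d%:R / (2 * k.+1%:R)) * N =
  1 / 2 * (Num.sqrt d%:R * (s * N / k.+1%:R)).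
  by field; rewrite -natr1 in k1 *; rewrite addrC gt_eqF.
by rewrite ler_wpM2l // ler_wpM2l ?sqrtr_ge0 // ler_pdivlMr // mulrC.
Qed.

(** With [y] and [z] the square roots of [d] and [k].  At [z = 1] the equation
    for [g] makes the difference of the two sides [2 g (z - (g - 1) y)^2]. *)
Lemma growth_rate_bound (R : realFieldType) (g y z : R) :
  0 < g -> g * (g - 1) = 1 / 2 -> 1 <= z ->
  y * (y + 2 * z ^+ 2) <= g * z * (y ^+ 2 + 2 * z ^+ 2).
Proof.
move=> g0 gE z1; rewrite -subr_ge0.
have -> : g * z * (y ^+ 2 + 2 * z ^+ 2) - y * (y + 2 * z ^+ 2) =
  z * (2 * g * (z - y * (g - 1)) ^+ 2) + y ^+ 2 * (z - 1)
  + 2 * (y * z ^+ 2 * 2 - z * y ^+ 2 * (g - 1)) * (g * (g - 1) - 1 / 2) by field.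
have z0 : 0 <= z by rewrite (le_trans _ z1).
rewrite gE subrr mulr0 addr0; apply: addr_ge0.
  by rewrite mulr_ge0 // mulr_ge0 ?sqr_ge0 // mulr_ge0 // ltW.
by rewrite mulr_ge0 ?sqr_ge0 ?subr_ge0.
Qed.

(** Induction on [k]: the ratio of consecutive majorants, divided by the new
    factor of the rising factorial, is at most the ratio of the bounds. *)
Lemma gradR_term_le (R : realType) (d k : nat) (S : 'M[R]_d) (g s : R) :
  S^T = S -> (0 < d)%N -> 0 < g -> g * (g - 1) = 1 / 2 -> fnorm S <= s ->
  fnorm (gradR_term S k.+1) <=
    (Num.sqrt d%:R)^-1 * ((g * s / Num.sqrt d%:R) ^+ k / Num.sqrt k`!%:R).
Proof.
move=> Ssym d0 g0 gE Ss; apply: le_trans (fnorm_gradR_term _ Ssym d0) _.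
have s0 : 0 <= s := le_trans (fnorm_ge0 _) Ss.
set y := Num.sqrt d%:R.
have y0 : 0 < y by rewrite sqrtr_gt0 ltr0n.
have yE : d%:R = y ^+ 2 :> R by rewrite sqr_sqrtr.
elim: k => [|k IH].
  rewrite expr0 fact0 sqrtr1 divr1 mulr1 /grad_majorant /rising_fact !big_ord1.
  rewrite expr0 fnorm1 -/y zonal_sum0 normr1 addr0 yE.
  by rewrite le_eqVlt; apply/orP; left; apply/eqP; field; rewrite gt_eqF.
pose z : R := Num.sqrt k.+1%:R.
have z1 : 1 <= z by rewrite -sqrtr1 ler_wsqrtr // ler1n.
have z0 : 0 < z := lt_le_trans ltr01 z1.
have zE : k.+1%:R = z ^+ 2 :> R by rewrite sqr_sqrtr.
have rf : 0 < rising_fact (d%:R / 2 : R) k.+1.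
  by rewrite rising_fact_gt0 ?divr_gt0 ?ltr0n.
have -> : rising_fact (d%:R / 2 : R) k.+2 =
    rising_fact (d%:R / 2) k.+1 * (y ^+ 2 / 2 + z ^+ 2).
  by rewrite /rising_fact big_ord_recr /= yE zE.
have -> : Num.sqrt k.+1`!%:R = z * Num.sqrt k`!%:R :> R.
  by rewrite factS natrM sqrtrM.
have den0 : 0 < y ^+ 2 / 2 + z ^+ 2.
  by rewrite addr_gt0 ?divr_gt0 ?exprn_gt0.
set rfk := rising_fact _ _ in rf IH *.
apply: (@le_trans _ _ ((s * (1 + y / (2 * z ^+ 2)) / (y ^+ 2 / 2 + z ^+ 2)) *
    (grad_majorant S k.+1 / rfk))).
  rewrite [leRHS]mulrACA -invfM [X in _ / X]mulrC.
  rewrite ler_pM2r ?invr_gt0 ?mulr_gt0 //.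
  by rewrite -zE; exact: grad_majorantS.
have -> : y^-1 * ((g * s / y) ^+ k.+1 / (z * Num.sqrt k`!%:R)) =
    (s * (g / (y * z))) * (y^-1 * ((g * s / y) ^+ k / Num.sqrt k`!%:R)).
  rewrite exprS; set w := _ ^+ k.
  have f0 : Num.sqrt k`!%:R != 0 :> R by rewrite gt_eqF // sqrtr_gt0 ltr0n fact_gt0.
  by field; rewrite !gt_eqF //= f0.
apply: ler_pM => //.
- rewrite divr_ge0 ?(ltW den0) // mulr_ge0 // addr_ge0 //.
  by rewrite divr_ge0 ?mulr_ge0 ?exprn_ge0 // ltW.
- by rewrite divr_ge0 ?grad_majorant_ge0 ?ltW.
rewrite -mulrA ler_wpM2l // ler_pdivrMr // mulrAC ler_pdivlMr ?mulr_gt0 //.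
have -> : (1 + y / (2 * z ^+ 2)) * (y * z) = y * (y + 2 * z ^+ 2) / (2 * z).
  by field; rewrite gt_eqF.
rewrite ler_pdivrMr ?mulr_gt0 //.
have -> : g * (y ^+ 2 / 2 + z ^+ 2) * (2 * z) = g * z * (y ^+ 2 + 2 * z ^+ 2) by field.
exact: growth_rate_bound.
Qed.

(** * Summing the series *)

Lemma sum_invfact_le (R : realType) n : \sum_(i < n) (i`!%:R)^-1 <= expR 1 :> R.
Proof.
have -> : \sum_(i < n) (i`!%:R)^-1 = series (exp_coeff (1 : R)) n.
  rewrite /series /= big_mkord; apply: eq_bigr => i _.
  by rewrite /exp_coeff /= expr1n mul1r.
apply: nondecreasing_cvgn_le (@is_cvg_series_exp_coeff R 1) n.
by apply: nondecreasing_series => k _ _; exact: exp_coeff_ge0.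
Qed.

Lemma sum_half_exp_le (R : realFieldType) n : \sum_(i < n) (1 / 2) ^+ i <= 2 :> R.
Proof.
suff -> : \sum_(i < n) (1 / 2) ^+ i = 2 - 2 * (1 / 2) ^+ n :> R.
  by rewrite lerBlDr lerDl mulr_ge0 // exprn_ge0.
elim: n => [|n IH]; first by rewrite big_ord0 expr0 mulr1 subrr.
by rewrite big_ord_recr IH exprS /=; field.
Qed.

Lemma sum_sqrt_fact_le (R : realType) (x : R) n : 0 <= x -> 2 * x ^+ 2 <= 1 ->
  \sum_(i < n) x ^+ i / Num.sqrt i`!%:R <= Num.sqrt (2 * expR 1).
Proof.
move=> x0 x1.
(* the weights [c ^+ i] split the sum into a geometric series of ratio 1/2 and
   a part of the exponential series, as needed for Cauchy-Schwarz *)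
pose c : R := Num.sqrt (1 / 2).
have c0 : 0 < c by rewrite sqrtr_gt0.
have cE : c ^+ 2 = 1 / 2 by rewrite sqr_sqrtr.
have -> : \sum_(i < n) x ^+ i / Num.sqrt i`!%:R =
    \sum_(i < n) ((x / c) ^+ i / Num.sqrt i`!%:R) * c ^+ i.
  apply: eq_bigr => i _; rewrite mulrAC; congr (_ / _).
  by rewrite -exprMn divfK // gt_eqF.
apply: le_trans (ler_norm _) _; apply: le_trans (l2norm_dot _ _) _.
rewrite mulrC sqrtrM //; apply: ler_pM; rewrite ?l2norm_ge0 // ler_wsqrtr //.
  apply: le_trans (sum_half_exp_le R n); apply: ler_sum => i _.
  by rewrite -exprM mulnC exprM cE.
apply: le_trans (sum_invfact_le R n); apply: ler_sum => i _.
rewrite expr_div_n sqr_sqrtr // ler_piMl ?invr_ge0 //.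
rewrite -exprM mulnC exprM [(x / c) ^+ 2]exprMn exprVn cE exprn_ile1 //.
  by rewrite divr_ge0 ?sqr_ge0.
by rewrite invf_div divr1 mulrC.
Qed.

(** Since [m`! * i`!] divides [(m + i)`!], the tail is at most its first term
    times the whole series. *)
Lemma tail_sqrt_fact_le (R : realType) (x : R) m n : 0 <= x -> 2 * x ^+ 2 <= 1 ->
  \sum_(m <= k < n) x ^+ k / Num.sqrt k`!%:R <=
    x ^+ m / Num.sqrt m`!%:R * Num.sqrt (2 * expR 1).
Proof.
move=> x0 x1; rewrite -{1}[m]add0n big_addn big_mkord.
apply: le_trans (_ : x ^+ m / Num.sqrt m`!%:R *
    (\sum_(i < n - m) x ^+ i / Num.sqrt i`!%:R) <= _); last first.
  by rewrite ler_wpM2l ?sum_sqrt_fact_le // divr_ge0 ?exprn_ge0 ?sqrtr_ge0.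
rewrite mulr_sumr; apply: ler_sum => i _.
rewrite mulrACA -exprD addnC ler_wpM2l ?exprn_ge0 //.
have f0 k : 0 < k`!%:R :> R by rewrite ltr0n fact_gt0.
rewrite -invfM -sqrtrM // lef_pV2 ?posrE ?sqrtr_gt0 ?mulr_gt0 //.
rewrite ler_wsqrtr // -natrM ler_nat -(bin_fact (leq_addr i m)) addKn.
by rewrite leq_pmull // bin_gt0 leq_addr.
Qed.

Lemma cvg_mx_entries (R : realType) (d : nat) (A : nat -> 'M[R]_d) (L : 'M[R]_d) :
  (forall i j, (fun n => A n i j) @ \oo --> L i j) -> A @ \oo --> L.
Proof.
move=> AL; apply/cvg_mx_entourageP => E entE.
apply: filter_forall => i; apply: filter_forall => j.
have /cvg_entourageP /(_ E entE) := AL i j.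
rewrite !near_map => H; near=> n.
by rewrite inE; near: n.
Unshelve. all: by end_near.
Qed.

(** Each entry of a matrix is at most its norm, so the series converges
    absolutely entry by entry; the bound on the partial sums passes to the limit
    because [\tr (A *m A)] is a polynomial in the entries of [A]. *)
Lemma cvg_frob_norm_sum (R : realType) (d m : nat) (A : nat -> 'M[R]_d) (B : R) :
  (forall k, (A k)^T = A k) ->
  (forall n, \sum_(m <= k < n) fnorm (A k) <= B) ->
  cvgn (fun n => \sum_(m <= k < n) A k) /\
  frob_norm (limn (fun n => \sum_(m <= k < n) A k)) <= B.
Proof.
move=> Asym AB; set p := fun n : nat => _.
have B0 : 0 <= B by apply: le_trans (AB 0%N); rewrite big_geq.
have cvg_entry i j : cvgn (fun n => p n i j).
  pose v k := if (m <= k)%N then A k i j else 0.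
  have -> : (fun n => p n i j) = series v.
    apply/funext => n; rewrite /p summxE /series /= /v.
    by rewrite (big_nat_widenl m 0) // big_mkcond.
  apply: normed_cvg; apply: nondecreasing_is_cvgn.
    exact: (@nondecreasing_series _ (fun k => `|v k|) xpredT 0%N).
  exists B => _ [n _ <-] /=; apply: le_trans (AB n).
  rewrite (big_nat_widenl m 0) // [leRHS]big_mkcond /=; apply: ler_sum => k _.
  by rewrite /v; case: ifP => _; rewrite ?normr0 ?fnorm_entry.
pose L : 'M[R]_d := \matrix_(i, j) limn (fun n => p n i j).
have pL i j : (fun n => p n i j) @ \oo --> L i j by rewrite mxE; exact: cvg_entry.
have {}cvg_entry : p @ \oo --> L by exact: cvg_mx_entries.
split; first by apply/cvg_ex; exists L.
rewrite (cvg_lim _ cvg_entry) //.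
have trE (C : 'M[R]_d) : \tr (C *m C) = \sum_i \sum_j C i j * C j i.
  by apply: eq_bigr => i _; rewrite mxE.
have cvg_tr : (fun n => \tr (p n *m p n)) @ \oo --> \tr (L *m L).
  rewrite trE; under eq_fun do rewrite trE.
  apply: cvg_big => [|i _]; first exact: add_continuous.
  apply: cvg_big => [|j _]; first exact: add_continuous.
  exact: cvgM (pL i j) (pL j i).
rewrite -(ger0_norm B0) -sqrtr_sqr ler_wsqrtr //.
apply: (cvgr_to_le cvg_tr); near=> n.
have psym : (p n)^T = p n by rewrite /p linear_sum /=; apply: eq_bigr.
have : frob_norm (p n) <= B.
  by rewrite frob_norm_sym //; apply: le_trans (fnorm_sum _ _ _) (AB n).
rewrite /frob_norm => H.
apply: le_trans (_ : Num.sqrt (\tr (p n *m p n)) ^+ 2 <= _).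
  case: (leP 0 (\tr (p n *m p n))) => [h|/ltW h]; first by rewrite sqr_sqrtr.
  by rewrite (le_trans h) ?sqr_ge0.
by rewrite ler_sqr // nnegrE ?sqrtr_ge0.
Unshelve. all: by end_near. Qed.

Lemma gradR_bound (R : realType) (d m : nat) (S : 'M[R]_d) (g s : R) :
  S^T = S -> (0 < d)%N -> 0 < g -> g * (g - 1) = 1 / 2 -> fnorm S <= s ->
  2 * (g * s / Num.sqrt d%:R) ^+ 2 <= 1 ->
  cvgn (gradR_psum m.+1 S) /\
  frob_norm (gradR m.+1 S) <= (Num.sqrt d%:R)^-1 *
    ((g * s / Num.sqrt d%:R) ^+ m / Num.sqrt m`!%:R * Num.sqrt (2 * expR 1)).
Proof.
move=> Ss d0 g0 gE Sle x1; apply: cvg_frob_norm_sum => [k|n].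
  exact: gradR_term_sym.
have s0 : 0 <= s := le_trans (fnorm_ge0 _) Sle.
set x := g * s / _ in x1 *.
have x0 : 0 <= x by rewrite divr_ge0 ?sqrtr_ge0 ?mulr_ge0 // ltW.
case: n => [|n].
  by rewrite big_geq // !mulr_ge0 ?invr_ge0 ?sqrtr_ge0 ?exprn_ge0.
rewrite big_add1 /=.
apply: (@le_trans _ _ ((Num.sqrt d%:R)^-1 *
    \sum_(m <= k < n) x ^+ k / Num.sqrt k`!%:R)).
  by rewrite mulr_sumr; apply: ler_sum => k _; apply: gradR_term_le.
by rewrite ler_wpM2l ?invr_ge0 ?sqrtr_ge0 // tail_sqrt_fact_le.
Qed.

(** * The estimate *)

Theorem proposition3p2 (R : realType) (gamma0 r : R)
    (Sigma : forall d : nat, 'M[R]_d)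
    (gamma0_gt0 : 0 < gamma0) (r_ge0 : 0 <= r) (r_lt1 : r < 1)
    (Sigma_sym : forall d : nat, (2 <= d)%N -> (Sigma d)^T = Sigma d)
    (Sigma_le : forall d : nat, (2 <= d)%N ->
       frob_norm (Sigma d) <= gamma0 * d%:R `^ (r / 2)) :
  let gamma1 : R := 1 / 2 * (1 + Num.sqrt 3) in
  let gamma2 : R := gamma0 * gamma1 in
  (forall m d : nat, (2 <= m)%N -> (2 <= d)%N ->
     (2 * gamma2 ^+ 2) `^ (1 / (1 - r)) <= d%:R ->
     cvgn (gradR_psum m (Sigma d)) /\
     frob_norm (gradR m (Sigma d)) <=
       (2 * expR 1) `^ (1 / 2) * gamma2 ^+ (m - 1) / ((m - 1)`!%:R) `^ (1 / 2) *
       d%:R `^ (- (1 + (m - 1)%:R * (1 - r)) / 2)) /\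
  (forall m : nat, (2 <= m)%N ->
     (fun d : nat => frob_norm (gradR m (Sigma d)) : R^o) =O_\oo
     (fun d : nat => d%:R `^ (- (1 + (m - 1)%:R * (1 - r)) / 2) : R^o)).
Proof.
move=> gamma1 gamma2.
have g0 : 0 < gamma1 by rewrite mulr_gt0 ?addr_gt0 ?sqrtr_gt0.
have gE : gamma1 * (gamma1 - 1) = 1 / 2.
  have s3 : Num.sqrt 3 ^+ 2 = 3 :> R by rewrite sqr_sqrtr.
  have -> : gamma1 * (gamma1 - 1) = (Num.sqrt 3 ^+ 2 - 1) / 4.
    by rewrite /gamma1; field.
  by rewrite s3; field.
have gamma2_gt0 : 0 < gamma2 by rewrite mulr_gt0.
have r1 : 0 < 1 - r by rewrite subr_gt0.
have main m d : (2 <= m)%N -> (2 <= d)%N ->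
    (2 * gamma2 ^+ 2) `^ (1 / (1 - r)) <= d%:R ->
    cvgn (gradR_psum m (Sigma d)) /\
    frob_norm (gradR m (Sigma d)) <=
      (2 * expR 1) `^ (1 / 2) * gamma2 ^+ (m - 1) / ((m - 1)`!%:R) `^ (1 / 2) *
      d%:R `^ (- (1 + (m - 1)%:R * (1 - r)) / 2).
  case: m => // m _ d2 dge; rewrite subn1 /=.
  have d0 : (0 < d)%N by rewrite (leq_trans _ d2).
  have D0 : 0 < d%:R :> R by rewrite ltr0n.
  have powD a b : d%:R `^ (a + b) = d%:R `^ a * d%:R `^ b :> R.
    by rewrite powRD // (gt_eqF D0) implybT.
  have sqrtE a : 0 <= a -> a `^ (1 / 2) = Num.sqrt a :> R.
    by move=> a0; rewrite div1r powR12_sqrt.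
  (* [x] is a pure power of [d], and [2 x^2 <= 1] is the lower bound on [d] *)
  have xE : gamma1 * (gamma0 * d%:R `^ (r / 2)) / Num.sqrt d%:R =
      gamma2 * d%:R `^ (- (1 - r) / 2).
    have -> : - (1 - r) / 2 = r / 2 + - (1 / 2) by field.
    rewrite powD powRN sqrtE ?(ltW D0) // /gamma2. ring.
  have Dr : 2 * gamma2 ^+ 2 <= d%:R `^ (1 - r).
    have pos : 0 <= 2 * gamma2 ^+ 2 by rewrite mulr_ge0 ?exprn_ge0 ?ltW.
    have := ge0_ler_powR (ltW r1) _ _ dge.
    by rewrite !nnegrE powR_ge0 -powRrM div1r mulVf ?gt_eqF // powRr1 // ltW //; apply.
  have x1 : 2 * (gamma1 * (gamma0 * d%:R `^ (r / 2)) / Num.sqrt d%:R) ^+ 2 <= 1.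
    rewrite xE exprMn mulrA -[(d%:R `^ _) ^+ 2]powR_mulrn ?powR_ge0 // -powRrM.
    rewrite divfK ?pnatr_eq0 // powRN ler_pdivrMr ?mul1r //.
    exact: powR_gt0.
  have Ssym := Sigma_sym _ d2.
  have Sle : fnorm (Sigma d) <= gamma0 * d%:R `^ (r / 2).
    by rewrite -frob_norm_sym // Sigma_le.
  have [cv le] := gradR_bound m Ssym d0 g0 gE Sle x1.
  split=> //; apply: le_trans le _.
  rewrite xE exprMn -[(d%:R `^ _) ^+ m]powR_mulrn ?powR_ge0 // -powRrM.
  rewrite !sqrtE ?ler0n ?mulr_ge0 ?expR_ge0 //.
  have -> : - (1 + m%:R * (1 - r)) / 2 = - (1 / 2) + - (1 - r) / 2 * m%:R by field.
  rewrite powD powRN sqrtE ?(ltW D0) //.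
  by rewrite le_eqVlt; apply/orP; left; apply/eqP; ring.
split=> // m m2; apply/eqO_exP.
exists ((2 * expR 1) `^ (1 / 2) * gamma2 ^+ (m - 1) / ((m - 1)`!%:R) `^ (1 / 2)).
  by rewrite !mulr_gt0 ?invr_gt0 ?powR_gt0 ?mulr_gt0 ?expR_gt0 ?exprn_gt0
    ?ltr0n ?fact_gt0.
near=> d.
rewrite ger0_norm ?sqrtr_ge0 // ger0_norm ?powR_ge0 //.
have [||//] := main m d m2; first by near: d; exact: nbhs_infty_ge.
by near: d; exact: nbhs_infty_ger.
Unshelve. all: by end_near. Qed.
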